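(* Let $\mathbb U,\mathbb V$ be nontrivial real Hilbert spaces, let $b:\mathbb U\times\mathbb V\to\mathbb R$ be a bilinear form satisfying the continuity, injectivity and surjectivity conditions given in the context, let $\ell:\mathbb V\to\mathbb R$ be a continuous linear functional, and let $u^*\in\mathbb U$ be the unique element with $b(u^*,v)=\ell(v)$ for all $v\in\mathbb V$. Let $B,B'$ be the operators associated with $b$ (see context). Let $\rho>0$, $\varepsilon>0$, let $u^0_\varepsilon\in\mathbb U$ be an initial guess, and let $\{u^k_\varepsilon\}_{k\ge0},\{u^{k}\}_{k\ge1}\subset\mathbb U$, $\{r^k\},\{r^k_\varepsilon\}\subset\mathbb V$, $\{\delta^k\},\{\delta^k_\varepsilon\}\subset\mathbb U$ satisfy, for all $k\ge0$, $$r^k=\arg\min_{r\in\mathbb V}\ \tfrac12\|r\|_{\mathbb V}^2-\ell(r)+b(u^k_\varepsilon,r),$$ $$\delta^k=\arg\min_{\delta\in\mathbb U}\ \tfrac12\|\delta\|_{\mathbb U}^2-b(\delta,r^k_\varepsilon),$$ $$u^{k+1}=\arg\min_{u\in\mathbb U}\ \|u-(u^k_\varepsilon+\rho\delta^k_\varepsilon)\|_{\mathbb U}^2,$$ together with the relative error bounds $$\|r^k_\varepsilon-r^k\|_{\mathbb V}\le\varepsilon\|r^k\|_{\mathbb V},\qquad \|\delta^k_\varepsilon-\delta^k\|_{\mathbb U}\le\varepsilon\|\delta^k\|_{\mathbb U},\qquad \|u^{k+1}_\varepsilon-u^{k+1}\|_{\mathbb U}\le\varepsilon\|\rho\delta^k_\varepsilon\|_{\mathbb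 U}.$$ If $\rho<2\|B\|^{-2}$ and $$\varepsilon^3+3\varepsilon^2+3\varepsilon<\frac{1-\|I-\rho B'B\|}{\rho\|B\|^2},$$ then $r^k_\varepsilon\to0$ in $\mathbb V$, $\delta^k_\varepsilon\to0$ in $\mathbb U$, and $u^k_\varepsilon\to u^*$ in $\mathbb U$ as $k\to\infty$.
   Context: $\mathbb U$ and $\mathbb V$ carry inner products $(\cdot,\cdot)_{\mathbb U}$, $(\cdot,\cdot)_{\mathbb V}$ with induced norms $\|\cdot\|_{\mathbb U}$, $\|\cdot\|_{\mathbb V}$; $\|\cdot\|$ on operators is the operator norm and $I$ is the identity on $\mathbb U$. Conditions on $b$: - Continuity: there is $M>0$ with $\sup_{v\in\mathbb V\setminus\{0\}}\frac{|b(u,v)|}{\|v\|_{\mathbb V}}\le M\|u\|_{\mathbb U}$ for all $u\in\mathbb U$. - Injectivity: there is $\gamma_1>0$ with $\sup_{v\in\mathbb V\setminus\{0\}}\frac{|b(u,v)|}{\|v\|_{\mathbb V}}\ge\gamma_1\|u\|_{\mathbb U}$ for all $u\in\mathbb U$. - Surjectivity: there is $\gamma_2>0$ with $\sup_{u\in\mathbb U\setminus\{0\}}\frac{|b(u,v)|}{\|u\|_{\mathbb U}}\ge\gamma_2\|v\|_{\mathbb V}$ for all $v\in\mathbb V$. Under these conditions the problem defining $u^*$ has a unique solution. The bounded operators $B:\mathbb U\to\mathbb V$ and $B':\mathbb V\to\mathbb U$ are defined by $(Bu,v)_{\mathbb V}=b(u,v)=(u,B'v)_{\mathbb U}$ for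 all $u\in\mathbb U$, $v\in\mathbb V$. The elements $r^k_\varepsilon$, $\delta^k_\varepsilon$, $u^{k+1}_\varepsilon$ are inexact versions (quasi-minimizers) of $r^k$, $\delta^k$, $u^{k+1}$; the only requirement on them is the relative error bounds in the claim. *)

(* Defs.v *)
From mathcomp Require Import all_boot all_order all_algebra.
From mathcomp Require Import all_classical all_reals all_analysis.
Import Order.TTheory GRing.Theory Num.Theory.
Import numFieldNormedType.Exports.

Set Implicit Arguments.
Unset Strict Implicit.
Unset Printing Implicit Defensive.

Local Open Scope classical_set_scope.
Local Open Scope ring_scope.

(* A real Hilbert space is a completeNormedModType over a realType together
   with an inner product, given as a {dot U for idfun} (a symmetric, bilinear
   and positive definite form), which induces its norm in the following sense. *)
Definition induces_norm (R : realType) (U : normedModType R)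
    (ip : {dot U for idfun}) : Prop :=
  forall u : U, `|u| = Num.sqrt (ip u u).

Section InfSup.
Variables (R : realType) (U V : normedModType R) (b : U -> V -> R).

(* The suprema are taken in \bar R: the real-valued sup of an unbounded set is
   0, which would make an unbounded form satisfy the continuity condition. *)
Definition sup_right (u : U) : \bar R :=
  ereal_sup [set (`|b u v| / `|v|)%:E | v in [set v : V | v != 0]].

Definition sup_left (v : V) : \bar R :=
  ereal_sup [set (`|b u v| / `|u|)%:E | u in [set u : U | u != 0]].

Definition form_continuous : Prop :=
  exists2 M : R, 0 < M & forall u : U, (sup_right u <= (M * `|u|)%:E)%E.

Definition form_injective : Prop :=
  exists2 gamma1 : R, 0 < gamma1 &
    forall u : U, ((gamma1 * `|u|)%:E <= sup_right u)%E.

Definition form_surjective : Prop :=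
  exists2 gamma2 : R, 0 < gamma2 &
    forall v : V, ((gamma2 * `|v|)%:E <= sup_left v)%E.

End InfSup.

(* The real-valued sup is the operator norm only when T is bounded and its
   domain is nontrivial; it must not be used on other maps. *)
Definition opnorm (R : realType) (U V : normedModType R) (T : U -> V) : R :=
  sup [set `|T u| / `|u| | u in [set u : U | u != 0]].

Definition is_argmin (R : realType) (T : Type) (J : T -> R) (x : T) : Prop :=
  forall y : T, J x <= J y.

(* Main.v *)
Require Import Defs.
From mathcomp Require Import all_boot all_order all_algebra.
From mathcomp Require Import all_classical all_reals all_analysis.
From mathcomp Require Import ring lra.
Import Order.TTheory GRing.Theory Num.Theory.
Import numFieldNormedType.Exports.

Local Open Scope classical_set_scope.
Local Open Scope ring_scope.

(** The minimizers are explicit: with the error [e k = ueps k - ustar], Riesz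
    representation gives [r k = - B (e k)], [delta k = B' (reps k)] and
    [u k.+1 = ueps k + rho deltaeps k].  Since [|B'| <= |B|], the three relative
    errors add up to
    [|e k.+1| <= (|I - rho B'B| + rho |B|^2 (eps^3 + 3 eps^2 + 3 eps)) |e k|],
    and the hypothesis on [eps] says that this factor is less than [1]. *)

Lemma dotC (R : realType) (U : lmodType R) (dot : {dot U for idfun}) (x y : U) :
  dot x y = dot y x.
Proof. by rewrite (hermC dot x y) expr0 mul1r. Qed.

Lemma dot_normE (R : realType) (U : normedModType R) (dot : {dot U for idfun})
  (x : U) : induces_norm dot -> dot x x = `|x| ^+ 2.
Proof.
move=> ->; rewrite sqr_sqrtr//.
have [->|x0] := eqVneq x 0; first by rewrite linear0l.
by rewrite ltW// neq0_dnorm_gt0.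
Qed.

Lemma dot_normD (R : realType) (U : normedModType R) (dot : {dot U for idfun})
  (x y : U) : induces_norm dot ->
  `|x + y| ^+ 2 = `|x| ^+ 2 + `|y| ^+ 2 + 2 * dot x y.
Proof.
move=> normU; rewrite -!(dot_normE _ _ _ _ normU) linearDl !linearDr/=.
by rewrite (dotC _ _ dot y x); ring.
Qed.

Lemma dot_normB (R : realType) (U : normedModType R) (dot : {dot U for idfun})
  (x y : U) : induces_norm dot ->
  `|x - y| ^+ 2 = `|x| ^+ 2 + `|y| ^+ 2 - 2 * dot x y.
Proof.
by move=> normU; rewrite (dot_normD _ _ dot)// normrN linearNr mulrN.
Qed.

(* Cauchy-Schwarz is read off the triangle inequality, which the norm satisfies
   by assumption. *)
Lemma dot_le_norm (R : realType) (U : normedModType R) (dot : {dot U for idfun})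
  (x y : U) : induces_norm dot -> dot x y <= `|x| * `|y|.
Proof.
move=> normU; have := dot_normD _ _ _ x y normU.
have : `|x + y| ^+ 2 <= (`|x| + `|y|) ^+ 2
  by rewrite lerXn2r ?nnegrE ?addr_ge0 ?ler_normD.
by rewrite sqrrD => + E; rewrite E; lra.
Qed.

(* Up to a constant, the functional is [|y - g|^2 / 2]. *)
Lemma argmin_riesz (R : realType) (U : normedModType R)
  (dot : {dot U for idfun}) (f : U -> R) (g x : U) : induces_norm dot ->
  (forall h, dot g h = f h) ->
  is_argmin (fun y => 2^-1 * `|y| ^+ 2 - f y) x -> x = g.
Proof.
move=> normU gf /(_ g) /=; rewrite -!gf (dot_normE _ _ _ _ normU) => le_xg.
apply/eqP; rewrite -subr_eq0 -normr_eq0 -sqrf_eq0 eq_le sqr_ge0 andbT.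
by rewrite (dot_normB _ _ dot)// (dotC _ _ dot x g); lra.
Qed.

Lemma argmin_dist (R : realType) (U : normedModType R) (a x : U) :
  is_argmin (fun w => `|w - a| ^+ 2) x -> x = a.
Proof.
move=> /(_ a) /=; rewrite subrr normr0 expr0n /= => le_xa.
by apply/eqP; rewrite -subr_eq0 -normr_eq0 -sqrf_eq0 eq_le le_xa sqr_ge0.
Qed.

(** If the quotients have no finite supremum, [sup] takes its default value 0; otherwise it
    dominates some quotient of norms. *)
Lemma opnorm_ge0 (R : realType) (U V : normedModType R) (T : U -> V) :
  0 <= opnorm T.
Proof.
rewrite /opnorm; set S := image _ _.
have [supS|/sup_out->//] := pselect (has_sup S).
have [_ [u u0 _]] := supS.1.
have Su : S (`|T u| / `|u|) by exists u.
by apply: le_trans (sup_upper_bound supS Su); rewrite divr_ge0.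
Qed.

(** The constant [C] bounds the quotients, so that [sup] is a genuine upper bound of them. At 0,
    where there is no quotient, the hypothesis itself forces [T 0 = 0]. *)
Lemma le_opnorm (R : realType) (U V : normedModType R) (T : U -> V) (C : R) :
  (forall u, `|T u| <= C * `|u|) -> forall u, `|T u| <= opnorm T * `|u|.
Proof.
move=> TC u; have [->|u0] := eqVneq u 0.
  by have := TC 0; rewrite normr0 !mulr0.
rewrite -ler_pdivrMr ?normr_gt0//; apply: ub_le_sup; last by exists u.
by exists C => _ [w w0 <-]; rewrite ler_pdivrMr ?normr_gt0.
Qed.

Lemma linear_le_opnorm (R : realType) (U V : normedModType R)
  (T : {linear U -> V}) : continuous T ->
  forall u, `|T u| <= opnorm T * `|u|.
Proof.
move=> /(_ 0) /continuous_linear_bounded /linear_boundedP [C [_ TC]].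
(* Boundedness is given for every constant strictly above [C], hence the choice of [C + 1]. *)
by apply: (le_opnorm _ _ _ _ (C + 1)) => u; apply: TC; rewrite ltrDl.
Qed.

(** By adjunction and Cauchy-Schwarz, [|T' v|^2 = dotV (T (T' v)) v <= C |T' v| |v|]; a nonzero
    [|T' v|] cancels. *)
Lemma adjoint_le (R : realType) (U V : normedModType R)
  (dotU : {dot U for idfun}) (dotV : {dot V for idfun})
  (T : U -> V) (T' : V -> U) (C : R) :
  induces_norm dotU -> induces_norm dotV -> 0 <= C ->
  (forall u v, dotV (T u) v = dotU u (T' v)) ->
  (forall u, `|T u| <= C * `|u|) -> forall v, `|T' v| <= C * `|v|.
Proof.
move=> normU normV C0 adj TC v; have [->|T'v0] := eqVneq (T' v) 0.
  by rewrite normr0 mulr_ge0.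
rewrite -(ler_pM2l (_ : 0 < `|T' v|)) ?normr_gt0//.
rewrite -expr2 -(dot_normE _ _ _ _ normU) -adj.
rewrite (le_trans (dot_le_norm _ _ _ _ _ normV))//.
by rewrite mulrA ler_wpM2r// mulrC.
Qed.

Lemma cvg0_le_geometric (R : realType) (U : normedModType R) (x : nat -> U)
  (C q : R) : 0 <= q < 1 -> (forall k, `|x k| <= C * q ^+ k) ->
  x @ \oo --> (0 : U).
Proof.
move=> /andP[q0 q1] xC; apply: norm_cvg0.
apply: (@squeeze_cvgr _ _ _ _ (fun=> 0) (geometric C q)).
- by apply: nearW => k; rewrite normr_ge0 xC.
- exact: cvg_cst.
- by apply: cvg_geometric; rewrite ger0_norm.
Qed.

Theorem theorem2 (R : realType) (U V : completeNormedModType R)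
  (dotU : {dot U for idfun}) (dotV : {dot V for idfun})
  (normU : induces_norm dotU) (normV : induces_norm dotV)
  (nontrivU : exists u : U, u != 0) (nontrivV : exists v : V, v != 0)
  (b : {bilinear U -> V -> R | *%R & *%R})
  (b_cont : form_continuous b) (b_inj : form_injective b)
  (b_surj : form_surjective b)
  (l : {scalar V}) (l_cont : continuous (l : V -> R))
  (ustar : U) (ustarP : forall v : V, b ustar v = l v)
  (B : {linear U -> V}) (B' : {linear V -> U})
  (B_cont : continuous B) (B'_cont : continuous B')
  (BP : forall (u : U) (v : V), dotV (B u) v = b u v)
  (B'P : forall (u : U) (v : V), b u v = dotU u (B' v))
  (rho eps : R) (rho_gt0 : 0 < rho) (eps_gt0 : 0 < eps)
  (u ueps : nat -> U) (r reps : nat -> V) (delta deltaeps : nat -> U)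
  (rP : forall k : nat,
     is_argmin (fun x : V => 2^-1 * `|x| ^+ 2 - l x + b (ueps k) x) (r k))
  (deltaP : forall k : nat,
     is_argmin (fun d : U => 2^-1 * `|d| ^+ 2 - b d (reps k)) (delta k))
  (uP : forall k : nat,
     is_argmin (fun w : U => `|w - (ueps k + rho *: deltaeps k)| ^+ 2) (u k.+1))
  (reps_err : forall k : nat, `|reps k - r k| <= eps * `|r k|)
  (deltaeps_err : forall k : nat,
     `|deltaeps k - delta k| <= eps * `|delta k|)
  (ueps_err : forall k : nat,
     `|ueps k.+1 - u k.+1| <= eps * `|rho *: deltaeps k|)
  (rho_lt : rho < 2 * opnorm B ^- 2)
  (eps_lt : eps ^+ 3 + 3 * eps ^+ 2 + 3 * eps <
     (1 - opnorm (fun w : U => w - rho *: B' (B w))) / (rho * opnorm B ^+ 2)) :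
  [/\ reps @ \oo --> (0 : V), deltaeps @ \oo --> (0 : U)
    & ueps @ \oo --> ustar].
Proof.
set N := opnorm B; set q0 := opnorm _ in eps_lt.
have N0 : 0 <= N by exact: opnorm_ge0.
have BN : forall w, `|B w| <= N * `|w| by exact: linear_le_opnorm.
have B'N : forall v, `|B' v| <= N * `|v|.
  by apply: (adjoint_le _ _ _ _ _ B) normU normV N0 _ BN => w v; rewrite BP.
(* The crude constant [1 + rho N^2] only shows that the supremum [q0] is finite; the bound obtained
   has the sharp constant [q0]. *)
have q0P w : `|w - rho *: B' (B w)| <= q0 * `|w|.
  apply: (le_opnorm _ _ _ (fun w => w - rho *: B' (B w)) (1 + rho * (N * N))) => {}w.
  rewrite (le_trans (ler_normB _ _))// normrZ gtr0_norm// mulrDl mul1r lerD2l//.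
  rewrite -!mulrA ler_pM2l// (le_trans (B'N _))//; exact: ler_wpM2l.
pose e k := ueps k - ustar.
(* Since [l] is [b ustar], the linear part [l - b (ueps k)] equals [- b (e k)], which [- B (e k)]
   represents. *)
have rE k : r k = - B (e k).
  apply: (argmin_riesz _ _ _ (fun x => l x - b (ueps k) x)) normV _ _.
    by move=> h; rewrite linearNl /= BP linearBl /= ustarP opprB.
  by move=> y; have := rP k y; rewrite !opprD !opprK !addrA.
have dE k : delta k = B' (reps k).
  apply: (argmin_riesz _ _ _ (fun d => b d (reps k))) normU _ (deltaP k).
  by move=> h; rewrite dotC B'P.
have uE k : u k.+1 = ueps k + rho *: deltaeps k by exact: argmin_dist (uP k).
have r_le k : `|r k| <= N * `|e k| by rewrite rE normrN.
have eps1 : 0 <= 1 + eps by lra.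
(* In this bound and the next two, each application of [B] or [B'] costs a factor [N], and each
   inexact solve a factor [1 + eps]. *)
have reps_le k : `|reps k| <= (1 + eps) * N * `|e k|.
  rewrite -(subrK (r k) (reps k)) (le_trans (ler_normD _ _))//.
  rewrite (le_trans (lerD (reps_err k) (lexx _)))//.
  by rewrite -{2}(mul1r `|r k|) -mulrDl addrC -mulrA ler_wpM2l.
have d_le k : `|delta k| <= (1 + eps) * N ^+ 2 * `|e k|.
  rewrite dE (le_trans (B'N _))// (le_trans (ler_wpM2l N0 (reps_le k)))//.
  by rewrite le_eqVlt; apply/orP; left; apply/eqP; ring.
have deps_le k : `|deltaeps k| <= (1 + eps) ^+ 2 * N ^+ 2 * `|e k|.
  rewrite -(subrK (delta k) (deltaeps k)) (le_trans (ler_normD _ _))//.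
  rewrite (le_trans (lerD (deltaeps_err k) (lexx _)))//.
  rewrite -{2}(mul1r `|delta k|) -mulrDl addrC.
  rewrite (le_trans (ler_wpM2l eps1 (d_le k)))//.
  by rewrite le_eqVlt; apply/orP; left; apply/eqP; ring.
(* The errors in [reps], [deltaeps] and [ueps] contribute [eps], [eps (1 + eps)] and
   [eps (1 + eps)^2], each times [rho N^2 |e k|]. The three factors sum to [(1 + eps)^3 - 1], the
   polynomial in [q]. *)
pose q := q0 + rho * N ^+ 2 * (eps ^+ 3 + 3 * eps ^+ 2 + 3 * eps).
have eS k : `|e k.+1| <= q * `|e k|.
  (* The new error is the exact iteration applied to [e k], plus the residual error carried through
     [B'], the error of the increment and that of the update. *)
  have -> : e k.+1 = (e k - rho *: B' (B (e k)))
      + rho *: B' (reps k - r k) + rho *: (deltaeps k - delta k)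
      + (ueps k.+1 - u k.+1).
    have -> : B' (reps k - r k) = delta k + B' (B (e k)).
      by rewrite linearB rE linearN opprK dE.
    rewrite (addrC (delta k)) scalerDr (addrA (e k - _)) subrK.
    rewrite -(addrA (e k)) -scalerDr (addrC (delta k)) subrK uE.
    by rewrite [RHS]addrC /e [ueps k - _ + _]addrAC [RHS]addrA subrK.
  have h1 := q0P (e k).
  have h2 : `|rho *: B' (reps k - r k)| <= rho * (N * (eps * (N * `|e k|))).
    rewrite normrZ gtr0_norm// ler_pM2l// (le_trans (B'N _))// ler_wpM2l//.
    by rewrite (le_trans (reps_err k))// ler_pM2l.
  have h3 : `|rho *: (deltaeps k - delta k)|
      <= rho * (eps * ((1 + eps) * N ^+ 2 * `|e k|)).
    rewrite normrZ gtr0_norm// ler_pM2l//.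
    by rewrite (le_trans (deltaeps_err k))// ler_pM2l.
  have h4 : `|ueps k.+1 - u k.+1|
      <= eps * (rho * ((1 + eps) ^+ 2 * N ^+ 2 * `|e k|)).
    by rewrite (le_trans (ueps_err k))// ler_pM2l// normrZ gtr0_norm// ler_pM2l.
  apply: le_trans (ler_normD _ _) _.
  have := ler_normD (e k - rho *: B' (B (e k)) + rho *: B' (reps k - r k))
    (rho *: (deltaeps k - delta k)).
  have := ler_normD (e k - rho *: B' (B (e k))) (rho *: B' (reps k - r k)).
  by rewrite /q; lra.
have q01 : 0 <= q < 1.
  have q00 : 0 <= q0 by exact: opnorm_ge0.
  have eps_pos : 0 < eps ^+ 3 + 3 * eps ^+ 2 + 3 * eps.
    by rewrite !addr_gt0 ?mulr_gt0 ?exprn_gt0.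
  apply/andP; split.
    by rewrite addr_ge0// !mulr_ge0 ?exprn_ge0 ?(ltW rho_gt0) ?(ltW eps_pos).
  (* If [B = 0], the bound on [eps] is a division by 0, that is [0]. *)
  have N_neq0 : N != 0.
    apply/eqP => N_eq0; move: eps_lt.
    by rewrite -/N N_eq0 expr0n mulr0 invr0 mulr0 ltNge (ltW eps_pos).
  have N_gt0 : 0 < N by rewrite lt0r N_neq0.
  move: eps_lt; rewrite -/N ltr_pdivlMr ?mulr_gt0 ?exprn_gt0// ltrBrDl.
  by rewrite /q [X in q0 + X]mulrC.
have e_le k : `|e k| <= `|e 0%N| * q ^+ k.
  elim: k => [|k IHk]; first by rewrite expr0 mulr1.
  rewrite (le_trans (eS k))// exprS mulrCA ler_wpM2l//.
  by case/andP: q01.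
(* Any sequence dominated by a multiple of [|e k|] inherits its geometric decay. The space [W] is
   arbitrary because [reps] lives in [V] and the other two sequences in [U]. *)
have geo (W : normedModType R) (x : nat -> W) (C : R) : 0 <= C ->
    (forall k, `|x k| <= C * `|e k|) -> x @ \oo --> (0 : W).
  move=> C0 xC; apply: (cvg0_le_geometric _ _ _ (C * `|e 0%N|)) q01 _ => k.
  by rewrite (le_trans (xC k))// -mulrA ler_wpM2l.
split.
- by apply: geo reps_le; rewrite mulr_ge0.
- by apply: geo deps_le; rewrite mulr_ge0 ?exprn_ge0.
- by apply/subr_cvg0; apply: (geo _ e 1) => // k; rewrite mul1r.
Qed.
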